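(* Let $m\ge6$ be finite. Then there are finite cylindric algebras of dimension $3$ that have infinite $m$-flat representations but do not have finite $m$-flat representations (i.e. no $m$-flat representation on a finite base).
   Context: For $\mathfrak A\in\mathsf{CA}_3$ (cylindric algebras of dimension 3), a relativized representation is an injective homomorphism $f$ into $\wp(V)$, $V\subseteq{}^3M$, $M=\bigcup_{s\in V}\mathrm{rng}(s)$ (the base), operations relativized to $V$; a $3$-clique is $C\subseteq M$ with all triples from $C$ in $V$; $\mathsf C^m(M)=\{s\in{}^mM:\mathrm{rng}(s)\text{ a }3\text{-clique}\}$. $M$ is $m$-square if whenever $s\in\mathsf C^m(M)$, $i<3$, $l:3\to m$ injective and $(s_{l(0)},s_{l(1)},s_{l(2)})\in f(c_ia)$, there is $t\in\mathsf C^m(M)$ agreeing with $s$ off $i$ with $(t_{l(0)},t_{l(1)},t_{l(2)})\in f(a)$; $M$ is $m$-flat if it is $m$-square and $\exists x_i\exists x_j\varphi\leftrightarrow\exists x_j\exists x_i\varphi$ holds at every $s\in\mathsf C^m(M)$ for all formulas $\varphi$ of the $m$-variable language with a ternary relation symbol for each element of $A$ under clique-guarded semantics (atomic $a(x_{l(0)},x_{l(1)},x_{l(2)})$ true at $s$ iff $(s_{l(0)},s_{l(1)},s_{l(2)})\in f(a)$; $\exists x_i$ ranges over $t\in\mathsf C^m(M)$ agreeing with $s$ off $i$).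
   Formalization: In the definition of m-square, t is required to agree with s off l(i) instead of off i; read literally (off i), the definition forces all 3-cliques to be singletons, so the algebra is discrete and has a finite m-flat representation, and the claim fails. *)

(* Defs.v *)
From mathcomp Require Import all_boot all_order.
From mathcomp Require Import boolp classical_sets functions cardinality.

Set Implicit Arguments.
Unset Strict Implicit.
Unset Printing Implicit Defensive.

Import Order.TTheory.

Local Open Scope classical_set_scope.

(* The axioms C1-C7 of Henkin, Monk and Tarski in dimension 3; C0, that A is
   a Boolean algebra, is carried by the type of A. *)
Record cylindric_algebra3 (d : Order.disp_t) (A : ctbDistrLatticeType d)
    (cyl : 'I_3 -> A -> A) (diag : 'I_3 -> 'I_3 -> A) : Prop := {
  cyl_bot : forall i, cyl i \bot%O = \bot%O;
  cyl_ge : forall i x, (x <= cyl i x)%O;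
  cyl_meet : forall i x y,
    cyl i (x `&` cyl i y)%O = (cyl i x `&` cyl i y)%O;
  cyl_comm : forall i j x, cyl i (cyl j x) = cyl j (cyl i x);
  diag_refl : forall i, diag i i = \top%O;
  diag_trans : forall i j k, k != i -> k != j ->
    diag i j = cyl k (diag i k `&` diag k j)%O;
  diag_subst : forall i j x, i != j ->
    (cyl i (diag i j `&` x) `&` cyl i (diag i j `&` ~` x))%O = \bot%O
}.

Definition agree_off (I : eqType) (M : Type) (i : I) (s t : I -> M) : Prop :=
  forall j, j != i -> t j = s j.

Definition rel_cyl (M : Type) (V : set ('I_3 -> M)) (i : 'I_3)
    (X : set ('I_3 -> M)) : set ('I_3 -> M) :=
  [set s | V s /\ exists2 t, X t & agree_off i s t].

Definition rel_diag (M : Type) (V : set ('I_3 -> M)) (i j : 'I_3) :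
    set ('I_3 -> M) :=
  [set s | V s /\ s i = s j].

Record relativized_representation (d : Order.disp_t)
    (A : ctbDistrLatticeType d)
    (cyl : 'I_3 -> A -> A) (diag : 'I_3 -> 'I_3 -> A)
    (M : Type) (V : set ('I_3 -> M)) (f : A -> set ('I_3 -> M)) : Prop := {
  (* all of M is the base, i.e. the union of the ranges of the s in V *)
  rep_base : \bigcup_(s in V) range s = [set: M];
  rep_sub : forall a, f a `<=` V;
  rep_inj : injective f;
  rep_bot : f \bot%O = set0;
  rep_top : f \top%O = V;
  rep_join : forall a b, f (a `|` b)%O = f a `|` f b;
  rep_meet : forall a b, f (a `&` b)%O = f a `&` f b;
  rep_compl : forall a, f (~` a)%O = V `\` f a;
  rep_cyl : forall i a, f (cyl i a) = rel_cyl V i (f a);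
  rep_diag : forall i j, f (diag i j) = rel_diag V i j
}.

Definition clique3 (M : Type) (V : set ('I_3 -> M)) (C : set M) : Prop :=
  forall s : 'I_3 -> M, range s `<=` C -> V s.

Definition clique_assignments (m : nat) (M : Type) (V : set ('I_3 -> M)) :
    set ('I_m -> M) :=
  [set s | clique3 V (range s)].

Arguments clique_assignments m {M} V.

(* The variable moved by the witness for c_i at (s_(l 0), s_(l 1), s_(l 2)) is
   the one holding the i-th coordinate of that triple, namely l i. *)
Definition square (m : nat) (A : Type) (cyl : 'I_3 -> A -> A)
    (M : Type) (V : set ('I_3 -> M)) (f : A -> set ('I_3 -> M)) : Prop :=
  forall (s : 'I_m -> M) (i : 'I_3) (l : 'I_3 -> 'I_m) (a : A),
    clique_assignments m V s -> injective l -> f (cyl i a) (s \o l) ->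
    exists t : 'I_m -> M,
      [/\ clique_assignments m V t, agree_off (l i) s t & f a (t \o l)].

(* Equality needs no atom of its own: it is expressed by the symbol of the
   diagonal element d_01. *)
Inductive formula (m : nat) (A : Type) : Type :=
| FAtom of A & ('I_3 -> 'I_m)
| FNot of formula m A
| FAnd of formula m A & formula m A
| FEx of 'I_m & formula m A.

Fixpoint sat (m : nat) (A M : Type) (V : set ('I_3 -> M))
    (f : A -> set ('I_3 -> M)) (s : 'I_m -> M) (phi : formula m A) : Prop :=
  match phi with
  | FAtom a l => f a (s \o l)
  | FNot p => ~ sat V f s p
  | FAnd p q => sat V f s p /\ sat V f s q
  | FEx i p => exists t : 'I_m -> M,
      [/\ clique_assignments m V t, agree_off i s t & sat V f t p]
  end.

Definition flat (m : nat) (A : Type) (cyl : 'I_3 -> A -> A)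
    (M : Type) (V : set ('I_3 -> M)) (f : A -> set ('I_3 -> M)) : Prop :=
  square m cyl V f /\
  forall (phi : formula m A) (i j : 'I_m) (s : 'I_m -> M),
    clique_assignments m V s ->
    sat V f s (FEx i (FEx j phi)) <-> sat V f s (FEx j (FEx i phi)).

Definition flat_representation (m : nat) (d : Order.disp_t)
    (A : ctbDistrLatticeType d)
    (cyl : 'I_3 -> A -> A) (diag : 'I_3 -> 'I_3 -> A)
    (M : Type) (V : set ('I_3 -> M)) (f : A -> set ('I_3 -> M)) : Prop :=
  relativized_representation cyl diag V f /\ flat m cyl V f.

(* Main.v *)
Require Import Defs.
From HB Require Import structures.
From mathcomp Require Import all_boot all_order.
From mathcomp Require Import boolp classical_sets functions cardinality.
From mathcomp Require Import zify.

(* The algebra consists of all sets of 3-types of a generic edge-coloured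
   complete graph on nat.  Call {x | g(z,x)} the plane of z.  The triangle
   constraints say that inside a plane any two points are related by an
   asymmetric relation without 3-cycles, of which s is a part, and that s is a
   partial function there.  Points sharing no plane may get the colour w, which
   leaves the composition of s with itself so vague that the algebra is finite.
   Genericity gives every point x of the plane of z an s-successor in that plane;
   in the relation "y is the n-th successor of x in the plane of z", successors
   are unique and lie strictly above x.  That relation needs a fourth variable,
   so it is not an element of the algebra, but it is definable in an m-flat
   representation.  Flatness moves the witnesses of two such definitions into one
   clique of six points, where the triangle constraints apply: all n-th
   successors of a point are therefore distinct, and the base is infinite. *)

Set Implicit Arguments.
Unset Strict Implicit.
Unset Printing Implicit Defensive.

Import Order.TTheory.
Import Order.DefaultSetSubsetOrder.

Local Open Scope classical_set_scope.

(** * The generic coloured graph *)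

(* On an edge from x to y: Cg, y is in the plane of x; Cs, y is a successor of
   x; Cl, y is above x without being a successor; Cw, none of these. Primes
   mark the converse colours. *)
Inductive color := Cid | Cg | Cg' | Cs | Cs' | Cl | Cl' | Cw.

Definition color_code (c : color) : 'I_8 :=
  inord match c with
  | Cid => 0 | Cg => 1 | Cg' => 2 | Cs => 3 | Cs' => 4 | Cl => 5 | Cl' => 6
  | Cw => 7 end.

Definition color_decode (i : 'I_8) : color :=
  nth Cw [:: Cid; Cg; Cg'; Cs; Cs'; Cl; Cl'] i.

Lemma color_codeK : cancel color_code color_decode.
Proof. by case; rewrite /color_decode inordK. Qed.

HB.instance Definition _ := Finite.copy color (can_type color_codeK).

Definition conv (c : color) : color :=
  match c with
  | Cg => Cg' | Cg' => Cg | Cs => Cs' | Cs' => Cs | Cl => Cl' | Cl' => Cl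
  | _ => c end.

Definition below (c : color) : bool :=
  match c with Cs | Cl => true | _ => false end.

Definition ordered (c : color) : bool := below c || below (conv c).

(* Unlike [==], which goes through the opaque [inord], [eqc] computes. *)
Definition eqc (c d : color) : bool :=
  match c, d with
  | Cid, Cid | Cg, Cg | Cg', Cg' | Cs, Cs | Cs', Cs' | Cl, Cl | Cl', Cl'
  | Cw, Cw => true
  | _, _ => false end.

Lemma eqcP c d : reflect (c = d) (eqc c d).
Proof. by case: c; case: d; constructor. Qed.

Lemma eqcE c d : eqc c d = (c == d).
Proof. by apply/eqcP/eqP. Qed.

(* The constraints on a triangle x, y, z that single out one of its corners;
   [triangle] imposes them at all six orderings of x, y, z. *)
Definition corner (xy yz xz : color) : bool :=
  [&& eqc xy Cid ==> eqc yz xz,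
      eqc xy Cg && eqc xz Cg ==> eqc yz Cid || ordered yz,
      ~~ [&& below xy, below yz & below (conv xz)] &
      eqc xy Cs && eqc xz Cs ==> ~~ ordered yz].

Definition triangle (xy yz xz : color) : bool :=
  [&& corner xy yz xz, corner (conv xy) xz yz, corner yz (conv xz) (conv xy),
      corner (conv yz) (conv xy) (conv xz), corner xz (conv yz) xy &
      corner (conv xz) xy (conv yz)].

Lemma triangleC12 xy yz xz :
  triangle xy yz xz = triangle (conv xy) xz yz.
Proof. by case: xy; case: yz; case: xz. Qed.

Lemma triangleC23 xy yz xz : triangle xy yz xz = triangle xz (conv yz) xy.
Proof. by case: xy; case: yz; case: xz. Qed.

Lemma convK : involutive conv.
Proof. by case. Qed.

(** * One-point extensions of coloured graphs *)

Record network (N : Type) (col : N -> N -> color) : Prop := {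
  network_id : forall x y, col x y = Cid <-> x = y;
  network_conv : forall x y, col y x = conv (col x y);
  network_triangle : forall x y z, triangle (col x y) (col y z) (col x z)
}.

(* The colour of an old node y to a new node n, when p and q are joined to n by
   k1 and k2: a new node in the plane of p or q is put on top of that plane, or
   at its bottom if it has to lie below p or q. *)
Definition default_color (k1 k2 py qy : color) : color :=
  if eqc k1 Cg && eqc py Cg || eqc k2 Cg && eqc qy Cg then
    (if below (conv k1) || below (conv k2) then Cl' else Cl)
  else Cw.

Lemma default_colorC k1 k2 py qy :
  default_color k1 k2 py qy = default_color k2 k1 qy py.
Proof. by rewrite /default_color orbC [below _ || _]orbC. Qed.

(** The order never turns into a cycle, because the new node goes on the side of [y] that [k1] and
    [k2] dictate. The only possible conflict is that [y] and the new node are both successors of [p]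
    in the plane of [q]. Then [y] already realises [k1] and [k2], which the last hypothesis
    excludes. *)
Lemma triangle_default k1 k2 py qy : k1 != Cid -> py != Cid ->
  ~ [/\ k1 = py, k2 = qy & Cg \in [:: k1; k2]] ->
  triangle py (default_color k1 k2 py qy) k1.
Proof.
rewrite !(inE, =^~ eqcE) => k1n pyn nwit.
have {nwit} : ~~ [&& eqc k1 py, eqc k2 qy & eqc Cg k1 || eqc Cg k2].
  by apply/negP => /and3P[/eqcP e1 /eqcP e2 e3]; apply: nwit; split; rewrite // -eqcE.
by move: k1n pyn; case: k1; case: py => //; case: k2 => //; case: qy.
Qed.

(** Default colours never contain [Cs] or [Cg], and with [k1], [k2] fixed they place the new node
    either above or below all the nodes it is ordered with, so no 3-cycle arises. *)
Lemma triangle_default2 k1 k2 e py qy px qx : e != Cid ->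
  triangle e (default_color k1 k2 py qy) (default_color k1 k2 px qx).
Proof.
rewrite /default_color -eqcE; set d := if _ || _ then Cl' else Cl.
have [->|->] : d = Cl' \/ d = Cl by rewrite /d; case: ifP; [left|right].
  by case: ifP => _; case: ifP => _; case: e.
by case: ifP => _; case: ifP => _; case: e.
Qed.

Definition new_row (col : nat -> nat -> color) (p q : nat) (k1 k2 : color)
    (y : nat) : color :=
  if y == p then k1 else if y == q then k2 else
  default_color k1 k2 (col p y) (col q y).

Definition extend (col : nat -> nat -> color) (n : nat) (row : nat -> color)
    (x y : nat) : color :=
  if x == n then (if y == n then Cid else conv (row y))
  else if y == n then row x else col x y.

(** Every stage is a network on all of [nat]; the nodes from [n] on are those not yet placed. *)
Definition isolated (col : nat -> nat -> color) (n : nat) : Prop :=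
  forall x y, n <= y -> x != y -> col x y = Cw.

Lemma isolated_extend col n p q k1 k2 : isolated col n -> p < n -> q < n ->
  isolated (extend col n (new_row col p q k1 k2)) n.+1.
Proof.
move=> iso pn qn x y ny xy; rewrite /extend.
have [xn|_] := eqVneq x n.
  rewrite gtn_eqF //= /new_row.
  rewrite /default_color !gtn_eqF ?(ltn_trans _ ny)// !(iso _ y) ?andbF//; lia.
by rewrite gtn_eqF// iso// ltnW.
Qed.

Lemma triangle_new_row col n p q k1 k2 x y : network col ->
  isolated col n -> p < n -> q < n -> k1 != Cid -> k2 != Cid ->
  triangle (col p q) k2 k1 ->
  (forall d, d < n -> col p d = k1 -> col q d = k2 -> False) ->
  x != y ->
  let r := new_row col p q k1 k2 in triangle (col x y) (r y) (r x).
Proof.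
move=> net iso pn qn k1n k2n tri nowit xy /=.
have nid z w : z != w -> col z w != Cid.
  by move=> zw; apply/eqP => /(network_id net) e; rewrite e eqxx in zw.
have plane z w : col z w = Cg -> w < n.
  move=> zw; rewrite ltnNge; apply/negP => nw.
  have [e|e] := eqVneq z w; first by rewrite (network_id net z w).2 in zw.
  by rewrite iso in zw.
(* A node that is not yet placed is joined to all others by [Cw], so a witness involving [Cg] lies
   below [n] and the bounded hypothesis applies. *)
have wit w : ~ [/\ k1 = col p w, k2 = col q w & Cg \in [:: k1; k2]].
  move=> [pw qw]; rewrite !inE => kg; apply: (nowit w) => //; move: kg.
  move=> /orP[] /eqP kg.
    by apply: (plane p); rewrite kg.
  by apply: (plane q); rewrite kg.
have main z w : z != w -> z \in [:: p; q] ->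
    triangle (col z w) (new_row col p q k1 k2 w) (new_row col p q k1 k2 z).
  move=> zw; rewrite /new_row !inE; have [zp _|zp /= /eqP zq] := eqVneq z p.
    subst z; rewrite eq_sym (negbTE zw).
    have [->//|wq] := eqVneq w q.
    by apply: triangle_default; [|apply: nid|].
  subst z; rewrite eqxx [w == q]eq_sym (negbTE zw).
  have [->|wp] := eqVneq w p.
    by rewrite triangleC12 -(network_conv net).
  rewrite default_colorC; apply: triangle_default; [by []|exact: nid|].
  by move=> [e1 e2]; rewrite !inE orbC => kg; apply: (wit w); split=> //; rewrite !inE.
have [xpq|xpq] := boolP (x \in [:: p; q]); first exact: main.
have [ypq|ypq] := boolP (y \in [:: p; q]).
  by rewrite triangleC12 -(network_conv net); apply: main; rewrite 1?eq_sym.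
move: xpq ypq; rewrite !inE !negb_or /new_row => /andP[/negbTE-> /negbTE->].
by move=> /andP[/negbTE-> /negbTE->]; apply/triangle_default2/nid.
Qed.

Lemma network_extend col n p q k1 k2 : network col ->
  isolated col n -> p < n -> q < n -> k1 != Cid -> k2 != Cid ->
  triangle (col p q) k2 k1 ->
  (forall d, d < n -> col p d = k1 -> col q d = k2 -> False) ->
  network (extend col n (new_row col p q k1 k2)).
Proof.
move=> net iso pn qn k1n k2n tri nowit.
set r := new_row _ _ _ _ _.
have rn y : r y != Cid.
  rewrite /r /new_row; case: ifP => // _; case: ifP => // _.
  by rewrite /default_color -eqcE; case: ifP => // _; case: ifP.
have key x y : x != n -> y != n -> triangle (col x y) (r y) (r x).
  move=> _ _; have [->|xy] := eqVneq x y.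
    by rewrite (network_id net y y).2//; case: (r y).
  by apply: triangle_new_row net iso pn qn k1n k2n tri nowit xy.
split.
- move=> x y; rewrite /extend.
  have [xn|xn] := eqVneq x n; have [yn|yn] := eqVneq y n; subst.
  + by [].
  + by split=> [|e]; [move: (rn y); case: (r y) => //; rewrite eqxx|rewrite e eqxx in yn].
  + by split=> [e|e]; [move: (rn x); rewrite e eqxx|rewrite e eqxx in xn].
  + exact: network_id.
- move=> x y; rewrite /extend.
  case: ifP => _; case: ifP => _ //; first by rewrite convK.
  exact: network_conv.
- move=> x y z; rewrite /extend.
  have [xn|xn] := eqVneq x n; have [yn|yn] := eqVneq y n;
    have [zn|zn] := eqVneq z n => //; subst; rewrite ?convK.
  + by case: (conv (r z)).
  + by case: (r y).
  + by rewrite triangleC12 convK triangleC23 convK; apply: key.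
  + by case: (r x).
  + by rewrite triangleC23 convK; apply: key.
  + exact: key.
  + exact: network_triangle.
Qed.

(* Stage [n.+1] attends to the request coded by the 2-adic valuation of [n], so
   every request comes up at arbitrarily late stages. *)
Fixpoint stage (n : nat) : nat -> nat -> color :=
  if n isn't n'.+1 then fun x y => if x == y then Cid else Cw else
  let col := stage n' in
  if (unpickle (logn 2 n') : option (nat * nat * color * color))
       is Some (p, q, k1, k2) then
    if [&& p < n', q < n', k1 != Cid, k2 != Cid, triangle (col p q) k2 k1 &
           ~~ [exists d : 'I_n', (col p d == k1) && (col q d == k2)]] then
      extend col n' (new_row col p q k1 k2)
    else col
  else col.

Lemma stageP n : network (stage n) /\ isolated (stage n) n.
Proof.
elim: n => [|n [net iso]].
  split; last by move=> x y _ /= /negbTE->.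
  split=> [x y|x y|x y z] /=.
  - by case: eqVneq => // xy; split=> // e; rewrite e eqxx in xy.
  - by rewrite eq_sym; case: ifP.
  - have [<-|xy] := eqVneq x y; first by case: ifP.
    by have [<-|yz] := eqVneq y z; [rewrite (negbTE xy)|case: ifP].
have iso' : isolated (stage n) n.+1 by move=> x y ny; apply: iso; lia.
rewrite /=; case: unpickle => [[[[p q] k1] k2]|]; last by [].
case: ifP => [/and5P[pn qn k1n k2n /andP[tri /existsPn nowit]]|_]; last by [].
split; last exact: isolated_extend.
apply: network_extend => // d dn pd qd.
by have := nowit (Ordinal dn); rewrite /= pd qd !eqxx.
Qed.

Lemma stageS n x y : x < n -> y < n -> stage n.+1 x y = stage n x y.
Proof.
move=> xn yn /=; case: unpickle => [[[[p q] k1] k2]|] //; case: ifP => // _.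
by rewrite /extend !ltn_eqF.
Qed.

Lemma stage_mono n m x y : x < n -> y < n -> n <= m ->
  stage m x y = stage n x y.
Proof.
move=> xn yn; elim: m => [|m IH]; first by rewrite leqn0 => /eqP->.
rewrite leq_eqVlt => /orP[/eqP-> //|nm].
by rewrite stageS ?IH //; lia.
Qed.

(** The limit of the stages: a colour is final once both of its nodes have been placed. *)
Definition col (x y : nat) : color := stage (maxn x y).+1 x y.

Lemma colE n x y : x < n -> y < n -> col x y = stage n x y.
Proof.
by move=> xn yn; rewrite /col; apply/esym/stage_mono; lia.
Qed.

Lemma network_col : network col.
Proof.
split=> [x y|x y|x y z].
- exact: (network_id (stageP _).1).
- by rewrite /col maxnC; exact: (network_conv (stageP _).1).
- pose n := (x + y + z).+1.
  rewrite !(@colE n) /n; try lia.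
  exact: (network_triangle (stageP _).1).
Qed.

Lemma col_id x : col x x = Cid.
Proof. exact/(network_id network_col). Qed.

(** Genericity. A request containing [Cid] is met by [p] or [q] itself; any other is either met by
    an old node or served by a new one when its turn comes. *)
Lemma col_ext p q k1 k2 : triangle (col p q) k2 k1 ->
  exists2 d, col p d = k1 & col q d = k2.
Proof.
have [->|k1n] := eqVneq k1 Cid.
  move=> tri; exists p; first exact: col_id.
  rewrite (network_conv network_col p).
  by move: tri; case: (col p q); case: k2.
have [->|k2n] := eqVneq k2 Cid.
  move=> tri; exists q; last exact: col_id.
  by move: tri; case: (col p q); case: k1 k1n.
move=> tri.
(* The valuation of [n] at 2 codes the request, and the factor [3 ^ (p + q)] makes [n] exceed [p]
   and [q]. *)
pose e := pickle (p, q, k1, k2); pose n := 2 ^ e * 3 ^ (p + q).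
have lpq : p + q < n.
  by rewrite (leq_trans (ltn_expl (p + q) (isT : 1 < 3)))// leq_pmull// expn_gt0.
have en : logn 2 n = e.
  by rewrite lognM ?expn_gt0// pfactorK// lognX (@lognE 2 3) muln0 addn0.
have pn : p < n by lia.
have qn : q < n by lia.
have En : unpickle (logn 2 n) = Some (p, q, k1, k2) by rewrite en pickleK.
have [/existsP[d /andP[/eqP pd /eqP qd]]|nowit] :=
    boolP [exists d : 'I_n, (stage n p d == k1) && (stage n q d == k2)].
  by exists d; rewrite (@colE n).
exists n; rewrite (@colE n.+1)// 1?ltnW//= En pn qn k1n k2n nowit.
  rewrite -(@colE n) // tri /= /extend ltn_eqF // eqxx /new_row.
  by rewrite eqxx.
rewrite -(@colE n) // tri /= /extend (ltn_eqF qn) eqxx /new_row eqxx.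
(* If [q = p] the row returns [k1], and the triangle over [Cid] forces [k1 = k2]. *)
have [qp|//] := eqVneq q p.
by move: tri; rewrite qp col_id; case: (k1); case: (k2).
Qed.

(** * The algebra of types *)

Definition update (I : eqType) (M : Type) (s : I -> M) (i : I) (a : M) : I -> M :=
  fun j => if j == i then a else s j.

Lemma update_id (I : eqType) (M : Type) (s : I -> M) i : update s i (s i) = s.
Proof. by apply/funext => j; rewrite /update; case: eqP => // ->. Qed.

Lemma agree_off_update (I : eqType) (M : Type) (s t : I -> M) i :
  agree_off i s t -> t = update s i (t i).
Proof.
by move=> st; apply/funext => j; rewrite /update; case: eqVneq => [->|/st].
Qed.

Lemma update_agree_off (I : eqType) (M : Type) (s : I -> M) i a :
  agree_off i s (update s i a).
Proof. by move=> j ji; rewrite /update (negbTE ji). Qed.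

(** Injectivity of [f] reduces each axiom to a pointwise check on unrestricted triples. *)
Lemma cylindric_algebra3_full (d : Order.disp_t) (A : ctbDistrLatticeType d)
    (cyl : 'I_3 -> A -> A) (diag : 'I_3 -> 'I_3 -> A) (M : Type)
    (f : A -> set ('I_3 -> M)) :
  relativized_representation cyl diag setT f -> cylindric_algebra3 cyl diag.
Proof.
move=> R.
have cylE i a s : f (cyl i a) s <-> exists x, f a (update s i x).
  rewrite (rep_cyl R) /rel_cyl /=; split=> [[_ [t ft /agree_off_update e]]|[x fx]].
    by exists (t i); rewrite -e.
  by split=> //; exists (update s i x) => //; apply: update_agree_off.
have diagE i j s : f (diag i j) s <-> s i = s j.
  by rewrite (rep_diag R) /rel_diag /=; split=> [[]|].
have meetE a b s : f (a `&` b)%O s <-> f a s /\ f b s by rewrite (rep_meet R).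
have ext a b : (forall s, f a s <-> f b s) -> a = b.
  by move=> ab; apply: (rep_inj R); apply/funext => s; apply/propext/ab.
have updC (s : 'I_3 -> M) i j x y : i != j ->
    update (update s i x) j y = update (update s j y) i x.
  move=> ij; apply/funext => k; rewrite /update.
  by have [->|//] := eqVneq k j; rewrite eq_sym (negbTE ij).
have updd (s : 'I_3 -> M) i x y : update (update s i x) i y = update s i y.
  by apply/funext => k; rewrite /update; case: eqP.
split.
- move=> i; apply: ext => s; rewrite cylE (rep_bot R).
  by split=> // -[].
- move=> i a; apply/meet_idPl/ext => s; rewrite meetE cylE.
  by split=> [[]//|fa]; split=> //; exists (s i); rewrite update_id.
- move=> i a b; apply: ext => s; rewrite cylE meetE !cylE; split.
    by case=> x; rewrite meetE cylE => -[fa [y]]; rewrite updd => fb; split;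
      [exists x|exists y].
  move=> [[x fa] [y fb]]; exists x; rewrite meetE; split=> //.
  by rewrite cylE; exists y; rewrite updd.
- move=> i j a; have [->//|ij] := eqVneq i j.
  apply: ext => s; rewrite !cylE; split=> -[x]; rewrite cylE => -[y fy];
    by exists y; rewrite cylE; exists x; rewrite updC // eq_sym.
- move=> i; apply: ext => s; rewrite (rep_top R) diagE.
  by split.
- move=> i j k ki kj; apply: ext => s; rewrite diagE cylE; split=> [ij|[x]].
    exists (s i); rewrite meetE !diagE /update eqxx.
    by rewrite !(eq_sym _ k) (negbTE ki) (negbTE kj).
  rewrite meetE !diagE /update eqxx !(eq_sym _ k) (negbTE ki) (negbTE kj).
  by case=> ->.
- move=> i j a ij; apply: ext => s; rewrite (rep_bot R) meetE !cylE.
  split=> // -[[x] + [y]]; rewrite !meetE !diagE /update !eqxx.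
  rewrite (eq_sym j) (negbTE ij) (rep_compl R) => -[-> fa] [-> [_]].
  exact.
Qed.

Section TypeAlgebra.
Context {N : Type} {K : finType} (ty : ('I_3 -> N) -> K).

(** Restricting to realised types is what makes [type_rep] injective. *)
Definition types := {k : K | `[< exists s, ty s = k >]}.

Definition type_of (s : 'I_3 -> N) : types :=
  exist _ (ty s) (asboolT (ex_intro _ s erefl)).

Lemma type_of_inj s t : type_of s = type_of t <-> ty s = ty t.
Proof. by split=> [[]//|st]; apply/val_inj. Qed.

Lemma type_of_onto k : exists s, type_of s = k.
Proof. by case: k => k kP; have /asboolP[s sk] := kP; exists s; apply/val_inj. Qed.

Definition type_cyl (i : 'I_3) (X : {set types}) : {set types} :=
  [set k | `[< exists s a, type_of s = k /\ type_of (update s i a) \in X >]]%SET.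

Definition type_diag (i j : 'I_3) : {set types} :=
  [set k | `[< exists s, type_of s = k /\ s i = s j >]]%SET.

Definition type_rep (X : {set types}) : set ('I_3 -> N) :=
  [set s | type_of s \in X].

Hypothesis ty_back_forth : forall s t i a, ty s = ty t ->
  exists b, ty (update t i b) = ty (update s i a).

Hypothesis ty_eq : forall s t i j, ty s = ty t -> s i = s j -> t i = t j.

(** The definition speaks of some triple of the given type; the back-and-forth hypothesis carries
    the moved point over to [s]. *)
Lemma in_type_cyl s i X :
  type_of s \in type_cyl i X <-> exists a, type_of (update s i a) \in X.
Proof.
rewrite finset.inE; split=> [/asboolP[t [a [/type_of_inj ts ta]]]|[a sa]].
  have [b /type_of_inj sb] := ty_back_forth i a ts.
  by exists b; rewrite sb.
by apply/asboolP; exists s, a.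
Qed.

Lemma in_type_diag s i j : type_of s \in type_diag i j <-> s i = s j.
Proof.
rewrite finset.inE; split=> [/asboolP[t [/type_of_inj ts]]|e].
  exact: ty_eq.
by apply/asboolP; exists s.
Qed.

Lemma type_rep_full : relativized_representation type_cyl type_diag setT type_rep.
Proof.
split.
- by rewrite -subTset => x _; exists (fun=> x) => //; exists ord0.
- by [].
- move=> X Y XY; apply/finset.setP => k; have [s <-] := type_of_onto k.
  by apply/idP/idP => h; [rewrite -[is_true _]/(type_rep Y s) -XY|
    rewrite -[is_true _]/(type_rep X s) XY].
- by apply/seteqP; split=> s //=; rewrite /type_rep /= finset.inE.
- by apply/seteqP; split=> s //=; rewrite /type_rep /= finset.inE.
- move=> X Y; apply/seteqP; split=> s /=; rewrite /type_rep /= finset.inE.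
    by case/orP; [left|right].
  by case=> ->; rewrite ?orbT.
- move=> X Y; apply/seteqP; split=> s /=; rewrite /type_rep /= finset.inE.
    by case/andP.
  by case=> -> ->.
- move=> X; apply/seteqP; split=> s /=; rewrite /type_rep /= finset.inE.
    by move=> /negP.
  by case=> _ /negP.
- move=> i X; apply/seteqP; split=> s /=; rewrite /type_rep /= => h.
    split=> //; have [a sa] := (in_type_cyl _ _ _).1 h.
    by exists (update s i a) => //; apply: update_agree_off.
  case: h => _ [t tX /agree_off_update e]; apply/in_type_cyl.
  by exists (t i); rewrite -e.
- move=> i j; apply/seteqP; split=> s /=; rewrite /type_rep /= => h.
    by split=> //; apply/in_type_diag.
  by apply/in_type_diag; case: h.
Qed.

End TypeAlgebra.

(** * Definability in flat representations *)

(** When [V] is everything, all assignments are cliques and the guarded quantifiers are ordinary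
    ones. *)
Lemma flat_full (m : nat) (d : Order.disp_t) (A : ctbDistrLatticeType d)
    (cyl : 'I_3 -> A -> A) (diag : 'I_3 -> 'I_3 -> A) (M : Type)
    (f : A -> set ('I_3 -> M)) :
  relativized_representation cyl diag setT f -> flat m cyl setT f.
Proof.
move=> R; split=> [s i l a _ linj|phi i j s _].
  rewrite (rep_cyl R) => -[_ [t ft st]]; exists (update s (l i) (t i)).
  split=> //; first exact: update_agree_off.
  rewrite [X in f a X](_ : _ = t) //; apply/funext => k.
  rewrite /update /=; case: eqVneq => [/linj -> //|lki].
  by rewrite st //; apply: contraNneq lki => ->.
have swap i' j' : sat setT f s (FEx i' (FEx j' phi)) ->
    sat setT f s (FEx j' (FEx i' phi)).
  move=> /= [t [_ st [u [_ tu su]]]]; exists (update s j' (u j')); split=> //.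
    exact: update_agree_off.
  exists u; split=> // k ki; rewrite /update; case: eqVneq => [->//|kj].
  by rewrite tu // st.
by split; apply: swap.
Qed.

Lemma clique3_sub (M : Type) (V : set ('I_3 -> M)) (C D : set M) :
  D `<=` C -> clique3 V C -> clique3 V D.
Proof. by move=> DC cC s sD; apply: cC => x /sD/DC. Qed.

Section Definability.
Context {m : nat} {A M : Type} (V : set ('I_3 -> M)) (f : A -> set ('I_3 -> M)).
Local Notation clique := (clique_assignments m V).
Implicit Types (P Q : ('I_m -> M) -> Prop) (s t : 'I_m -> M).

Definition definable P : Prop :=
  exists phi : formula m A, forall s, clique s -> P s <-> sat V f s phi.

Definition ex_var (i : 'I_m) P s : Prop :=
  exists t, [/\ clique t, agree_off i s t & P t].

(** Both assignments must be cliques, so independence of several variables does not directly compare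
    two cliques whose union is not a clique. *)
Definition indep (j : 'I_m) P : Prop :=
  forall s t, clique s -> clique t -> agree_off j s t -> P s -> P t.

Lemma definable_ex_var i P : definable P -> definable (ex_var i P).
Proof.
move=> [phi Pphi]; exists (FEx i phi) => s cs /=.
by split=> -[t [ct st h]]; exists t; split=> //; apply/(Pphi _ ct).
Qed.

Lemma definable_and P Q : definable P -> definable Q ->
  definable (fun s => P s /\ Q s).
Proof.
move=> [phi Pphi] [psi Qpsi]; exists (FAnd phi psi) => s cs /=.
by rewrite (propext (Pphi _ cs)) (propext (Qpsi _ cs)).
Qed.

Lemma definable_iff P Q : (forall s, clique s -> P s <-> Q s) ->
  definable P -> definable Q.
Proof.
by move=> PQ [phi Pphi]; exists phi => s cs; rewrite -(propext (PQ _ cs)) Pphi.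
Qed.

Lemma agree_off_sym (j : 'I_m) s t : agree_off j s t -> agree_off j t s.
Proof. by move=> st k kj; rewrite st. Qed.

Hypothesis commute : forall (phi : formula m A) (i j : 'I_m) s, clique s ->
  sat V f s (FEx i (FEx j phi)) <-> sat V f s (FEx j (FEx i phi)).

(** Flatness enters here. The witness at [s] makes the double quantifier over [j], [i] true at [t];
    after the exchange the value for [i] is chosen first, in a clique with the values of [t] off
    [i], and the later change at [j] is undone by independence. *)
Lemma indep_ex_var i j P : definable P -> indep j P -> indep j (ex_var i P).
Proof.
move=> [phi Pphi] jP s t cs ct st [u [cu su Pu]].
have : sat V f t (FEx i (FEx j phi)).
  apply/(commute _ _ _ ct); exists s; split=> //; first exact: agree_off_sym.
  by exists u; split=> //; apply/(Pphi _ cu).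
move=> /= [v [cv tv [w [cw vw sw]]]]; exists v; split=> //.
by apply: (jP w v) => //; [exact: agree_off_sym|apply/(Pphi _ cw)].
Qed.

Lemma indep_ex_var_self i P : indep i (ex_var i P).
Proof.
move=> s t cs ct st [u [cu su Pu]]; exists u; split=> // k ki.
by rewrite su // st.
Qed.

Lemma clique_range s t : clique s -> range t `<=` range s -> clique t.
Proof. by move=> cs ts; apply: clique3_sub cs. Qed.

(** Values are exchanged one variable at a time; all intermediate assignments stay inside the clique
    spanned by [s]. *)
Lemma indep_range (J : {set 'I_m}) P s t : (forall j, j \notin J -> indep j P) ->
  clique s -> range t `<=` range s -> {in J, s =1 t} -> P s <-> P t.
Proof.
move=> indP cs ts eJ.
pose h (l : seq 'I_m) i := if i \in l then t i else s i.
have ch l : clique (h l).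
  apply: (clique_range cs) => _ [i _ <-]; rewrite /h; case: ifP => _.
    by apply: ts; exists i.
  by exists i.
suff H l : P s <-> P (h l).
  rewrite (H (enum 'I_m)) (_ : h _ = t) //; apply/funext => i.
  by rewrite /h mem_enum.
elim: l => [|j l IH]; first by rewrite (_ : h _ = s).
have [jJ|jJ] := boolP (j \in J).
  rewrite IH (_ : h (j :: l) = h l) //; apply/funext => i; rewrite /h inE.
  by case: eqVneq => //= ->; rewrite (eJ _ jJ); case: ifP.
have hh : agree_off j (h l) (h (j :: l)).
  by move=> i ij; rewrite /h inE (negbTE ij).
rewrite IH; split; apply: (indP j jJ) => //.
exact: agree_off_sym.
Qed.

(** Both [s] and [t] are compared with an assignment [u] that uses only their common values on [J],
    so neither clique is left; [j0] supplies the filler value. *)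
Lemma indep_eq_on (J : {set 'I_m}) j0 P s t : j0 \in J ->
  (forall j, j \notin J -> indep j P) -> clique s -> clique t ->
  {in J, s =1 t} -> P s -> P t.
Proof.
move=> j0J indP cs ct st.
pose u i := if i \in J then s i else s j0.
have uJ : {in J, s =1 u} by move=> i iJ; rewrite /u iJ.
rewrite (indep_range indP cs _ uJ); last first.
  by move=> _ [i _ <-]; rewrite /u; case: ifP => _; [exists i|exists j0].
apply: (indep_range indP ct _ _).2; last by move=> i iJ; rewrite -st // uJ.
move=> _ [i _ <-]; rewrite /u; case: ifP => iJ; first by exists i; rewrite ?st.
by exists j0; rewrite ?st.
Qed.

(* A witness found over the values of [J] alone can be moved into a clique
   with all of [s]. *)
Lemma flat_witness (J : {set 'I_m}) j0 q Q s t : definable Q -> j0 \in J ->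
  q \notin J -> (forall j, j \notin q |: J -> indep j Q)%SET ->
  clique s -> clique t -> {in J, s =1 t} -> Q t ->
  exists u, clique (update s q u) /\ Q (update s q u).
Proof.
move=> dQ j0J qJ indQ cs ct st Qt.
have : ex_var q Q s.
  apply: (indep_eq_on j0J _ ct cs); last by exists t; split.
    move=> j jJ; have [->|jq] := eqVneq j q; first exact: indep_ex_var_self.
    by apply: indep_ex_var => //; apply: indQ; rewrite in_setU1 negb_or jq.
  by move=> j jJ; rewrite st.
by move=> [u [cu /agree_off_update su Qu]]; exists (u q); rewrite -su.
Qed.

End Definability.

(** * Colours and iterated successors in a representation *)

Local Notation o0 := (@Ordinal 3 0 isT).
Local Notation o1 := (@Ordinal 3 1 isT).
Local Notation o2 := (@Ordinal 3 2 isT).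

Definition triple (M : Type) (x y z : M) (i : 'I_3) : M := nth x [:: x; y; z] i.

Lemma ord3P (P : 'I_3 -> Prop) : P o0 -> P o1 -> P o2 -> forall i, P i.
Proof.
move=> P0 P1 P2 [[|[|[|//]]] i3].
- by rewrite (_ : Ordinal _ = o0) //; apply/val_inj.
- by rewrite (_ : Ordinal _ = o1) //; apply/val_inj.
- by rewrite (_ : Ordinal _ = o2) //; apply/val_inj.
Qed.

Lemma tripleE (M : Type) (s : 'I_3 -> M) : s = triple (s o0) (s o1) (s o2).
Proof. by apply/funext; apply: ord3P. Qed.

Lemma comp_triple (I M : Type) (s : I -> M) i j k :
  s \o triple i j k = triple (s i) (s j) (s k).
Proof. by apply/funext; apply: ord3P. Qed.

Definition ty (s : 'I_3 -> nat) : color * color * color :=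
  (col (s o0) (s o1), col (s o0) (s o2), col (s o1) (s o2)).

(** The edge between the two fixed coordinates has the same colour in [s] and [t], so [col_ext]
    realises over [t] the triangle that [a] completes over [s]. *)
Lemma ty_back_forth s t i a : ty s = ty t ->
  exists b, ty (update t i b) = ty (update s i a).
Proof.
have tri := network_triangle network_col; have cv := network_conv network_col.
case=> e01 e02 e12; elim/ord3P: i; rewrite /ty /update /=.
- have [|b b1 b2] := @col_ext (t o1) (t o2) (conv (col a (s o1))) (conv (col a (s o2))).
    by rewrite -e12 -!cv.
  by exists b; rewrite -e12 (cv (t o1)) (cv (t o2)) b1 b2 !convK.
- have [|b b1 b2] := @col_ext (t o0) (t o2) (col (s o0) a) (conv (col a (s o2))).
    by rewrite -e02 -!cv.
  by exists b; rewrite -e02 (cv (t o2)) b1 b2 convK.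
- have [|b b1 b2] := @col_ext (t o0) (t o1) (col (s o0) a) (col (s o1) a).
    by rewrite -e01.
  by exists b; rewrite -e01 b1 b2.
Qed.

Lemma ty_eq s t i j : ty s = ty t -> s i = s j -> t i = t j.
Proof.
case=> e01 e02 e12; have cid := network_id network_col.
elim/ord3P: i; elim/ord3P: j => // e.
- by apply/cid; rewrite -e01; apply/cid.
- by apply/cid; rewrite -e02; apply/cid.
- by apply/esym/cid; rewrite -e01; apply/cid.
- by apply/cid; rewrite -e12; apply/cid.
- by apply/esym/cid; rewrite -e02; apply/cid.
- by apply/esym/cid; rewrite -e12; apply/cid.
Qed.

Definition cyl3 := @type_cyl _ _ ty.
Definition diag3 := @type_diag _ _ ty.

(** * Colours read off a relativized representation *)

Section Representation.
Context {M : Type} {V : set ('I_3 -> M)} {f : {set types ty} -> set ('I_3 -> M)}.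
Hypothesis rep : relativized_representation cyl3 diag3 V f.

Definition matches (v : 'I_3 -> M) (s : 'I_3 -> nat) : Prop :=
  forall X, f X v <-> type_of ty s \in X.

(** The algebra is finite, so splitting atoms off the unit one by one reaches the atom that holds at
    [v]. *)
Lemma matches_ex v : V v -> exists s, matches v s.
Proof.
rewrite -(rep_top rep) => fv.
have [k kv] : exists k, f [set k]%SET v.
  move: fv; move: (\top%O : {set types ty}) => X; have [n] := ubnP #|X|.
  elim: n X => // n IH X Xn fX.
  have [X0|[k kX]] := finset.set_0Vmem X.
    by move: fX; rewrite X0 (rep_bot rep).
  move: fX; rewrite -(finset.setD1K kX) (rep_join rep) => -[|]; first by exists k.
  by apply: IH; move: Xn; rewrite (cardsD1 k) kX.
have [s sk] := type_of_onto k; exists s => X; rewrite sk; split=> [fX|kX].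
  apply/negPn/negP => kX; have : f ([set k]%SET `&` X)%O v by rewrite (rep_meet rep).
  rewrite (_ : (_ `&` _)%O = \bot%O) ?(rep_bot rep) //.
  by apply/eqP; rewrite finset.setI_eq0 disjoints1.
by rewrite -(finset.setD1K kX) (rep_join rep); left.
Qed.

Lemma matches_onto s : exists2 v, V v & matches v s.
Proof.
suff [v fv] : exists v, f [set type_of ty s]%SET v.
  have Vv : V v by apply: (rep_sub rep) fv.
  exists v => //; have [t mt] := matches_ex Vv.
  by move/mt: fv; rewrite finset.in_set1 /matches => /eqP <-.
apply: contrapT => nex; suff: [set type_of ty s]%SET = finset.set0.
  by move/finset.setP/(_ (type_of ty s)); rewrite !finset.inE eqxx.
apply: (rep_inj rep); rewrite [RHS](rep_bot rep); apply/seteqP; split=> // v fv.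
by apply: nex; exists v.
Qed.

Lemma matches_agree_off i v w s t : V v -> agree_off i v w ->
  matches v s -> matches w t -> exists a, ty (update s i a) = ty t.
Proof.
move=> Vv vw ms mt.
have /ms/(in_type_cyl ty_back_forth)[a] : f (cyl3 i [set type_of ty t]%SET) v.
  rewrite (rep_cyl rep); split=> //; exists w => //.
  by apply/mt; rewrite finset.in_set1.
by rewrite finset.in_set1 => /eqP/type_of_inj; exists a.
Qed.

Lemma matches_eq i j v s : V v -> matches v s -> v i = v j <-> s i = s j.
Proof.
move=> Vv ms.
have := ms (diag3 i j); rewrite (rep_diag rep) (propext (in_type_diag ty_eq _ _ _)).
by move=> <-; split=> [|[]].
Qed.

(** The cylindrification of [diag3 i j] along [i] is the unit, and its witness at [v] lies in
    [V]. *)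
Lemma rep_update i j v : V v -> V (update v i (v j)).
Proof.
move=> Vv; have [s ms] := matches_ex Vv.
have [t [Vt tij] /agree_off_update e] :
    exists2 t, V t /\ t i = t j & agree_off i v t.
  have : f (cyl3 i (diag3 i j)) v.
    apply/ms/(in_type_cyl ty_back_forth); exists (s j).
    apply/(in_type_diag ty_eq); rewrite /update eqxx.
    by case: (eqVneq j i) => // ->.
  rewrite (rep_cyl rep) => -[_ [t]]; rewrite (rep_diag rep) => tt vt.
  by exists t.
have [ij|ij] := eqVneq i j; first by rewrite -ij update_id.
have <- : t i = v j by rewrite tij e /update eq_sym (negbTE ij).
by rewrite -e.
Qed.

(** Substitutions by [rep_update] generate all eight triples over two points. *)
Lemma pair_clique x y z : V (triple x y z) -> clique3 V [set x; y].
Proof.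
have U i j (a b c : M) : V (triple a b c) ->
    V (triple (update (triple a b c) i (triple a b c j) o0)
      (update (triple a b c) i (triple a b c j) o1)
      (update (triple a b c) i (triple a b c j) o2)).
  by rewrite -tripleE; apply: rep_update.
move=> V0; have V1 : V (triple x y y) := U o2 o1 _ _ _ V0.
have V2 : V (triple x y x) := U o2 o0 _ _ _ V0.
have V3 : V (triple y y x) := U o0 o1 _ _ _ V2.
have V4 : V (triple x x y) := U o1 o0 _ _ _ V1.
have V5 : V (triple y x y) := U o0 o2 _ _ _ V4.
have V6 : V (triple y x x) := U o2 o1 _ _ _ V5.
have V7 : V (triple x x x) := U o2 o0 _ _ _ V4.
have V8 : V (triple y y y) := U o2 o0 _ _ _ V3.
move=> s sxy; rewrite (tripleE s).
have H i : s i = x \/ s i = y by apply: sxy; exists i.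
by case: (H o0) => ->; case: (H o1) => ->; case: (H o2) => ->.
Qed.

(** A representation interprets triples only, so a pair is coded by repeating its second point. *)
Definition hascol (c : color) (x y : M) : Prop :=
  exists2 s, matches (triple x y y) s & col (s o0) (s o1) = c.

Lemma hascol_fun c d x y : hascol c x y -> hascol d x y -> c = d.
Proof.
move=> [s ms <-] [t mt <-].
have : type_of ty s \in [set type_of ty t]%SET.
  by apply/ms/mt; rewrite finset.in_set1.
by rewrite finset.in_set1 => /eqP/type_of_inj[].
Qed.

Lemma matches_hascol01 x y z s : V (triple x y z) -> V (triple x y y) ->
  matches (triple x y z) s -> hascol (col (s o0) (s o1)) x y.
Proof.
move=> Vz Vy ms; have [t mt] := matches_ex Vy.
have [|a [e _ _]] := @matches_agree_off o2 _ _ _ _ Vz _ ms mt.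
  by apply: ord3P.
by exists t.
Qed.

Lemma clique_triple (C : set M) x y z :
  clique3 V C -> C x -> C y -> C z -> V (triple x y z).
Proof. by move=> cC Cx Cy Cz; apply: cC => _ [i _ <-]; elim/ord3P: i. Qed.

(** Inside a clique, moving one coordinate at a time leads from a triple to the degenerate ones that
    define [hascol], and each move preserves the colour of the fixed edge. *)
Lemma matches_hascol (C : set M) x y z s :
  clique3 V C -> C x -> C y -> C z -> matches (triple x y z) s ->
  [/\ hascol (col (s o0) (s o1)) x y, hascol (col (s o0) (s o2)) x z &
      hascol (col (s o1) (s o2)) y z].
Proof.
move=> cC Cx Cy Cz ms.
have h02 a b c t : C a -> C b -> C c -> matches (triple a b c) t ->
    hascol (col (t o0) (t o2)) a c.
  move=> Ca Cb Cc mt.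
  have Vacc : V (triple a c c) by apply: clique_triple cC _ _ _.
  have Vabc : V (triple a b c) by apply: clique_triple cC _ _ _.
  have [u mu] := matches_ex Vacc; exists u => //.
  have [|w [_ e _]] := @matches_agree_off o1 _ _ _ _ Vabc _ mt mu.
    by apply: ord3P.
  by rewrite (_ : u o1 = u o2) -?e //; apply/(matches_eq o1 o2 Vacc mu).
have Vxyz : V (triple x y z) by apply: clique_triple cC _ _ _.
have Vyyz : V (triple y y z) by apply: clique_triple cC _ _ _.
split; [|exact: h02 ms|].
  by apply: matches_hascol01 ms => //; apply: clique_triple cC _ _ _.
have [t mt] := matches_ex Vyyz.
have [|a [_ _ e]] := @matches_agree_off o0 _ _ _ _ Vxyz _ ms mt.
  by apply: ord3P.
have := h02 _ _ _ _ Cy Cy Cz mt.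
by rewrite (_ : t o0 = t o1) -?e //; apply/(matches_eq o0 o1 Vyyz mt).
Qed.

Lemma hascol_ex (C : set M) x y : clique3 V C -> C x -> C y ->
  exists c, hascol c x y.
Proof.
move=> cC Cx Cy; have [s ms] := matches_ex (clique_triple cC Cx Cy Cy).
by exists (col (s o0) (s o1)), s.
Qed.

Lemma hascol_id (C : set M) x y : clique3 V C -> C x -> C y ->
  hascol Cid x y <-> x = y.
Proof.
move=> cC Cx Cy; have [s ms] := matches_ex (clique_triple cC Cx Cy Cy).
have E := matches_eq o0 o1 (clique_triple cC Cx Cy Cy) ms.
split=> [[t mt /(network_id network_col) t01]|xy].
  by apply/(matches_eq o0 o1 (clique_triple cC Cx Cy Cy) mt).
by exists s => //; apply/(network_id network_col)/E.
Qed.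

Lemma hascol_triangle (C : set M) x y z a b c : clique3 V C -> C x -> C y -> C z ->
  hascol a x y -> hascol b y z -> hascol c x z -> triangle a b c.
Proof.
move=> cC Cx Cy Cz xy yz xz.
have [s ms] := matches_ex (clique_triple cC Cx Cy Cz).
have [xy' xz' yz'] := matches_hascol cC Cx Cy Cz ms.
rewrite (hascol_fun xy xy') (hascol_fun yz yz') (hascol_fun xz xz').
exact: network_triangle network_col _ _ _.
Qed.

Definition in_plane (c : color) : {set types ty} :=
  [set k | val k == (Cg, Cg, c)]%SET.

Definition plane_edge (c : color) (z x y : M) : Prop :=
  f (in_plane c) (triple z x y).

Lemma plane_edge_hascol (C : set M) z x y c :
  clique3 V C -> C z -> C x -> C y -> plane_edge c z x y ->
  [/\ hascol Cg z x, hascol Cg z y & hascol c x y].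
Proof.
move=> cC Cz Cx Cy h.
have [s ms] := matches_ex (clique_triple cC Cz Cx Cy).
have := matches_hascol cC Cz Cx Cy ms.
by move/ms: h; rewrite finset.inE => /eqP /= [-> -> ->].
Qed.

Lemma plane_edge_id (C : set M) z x : clique3 V C -> C z -> C x ->
  hascol Cg z x -> plane_edge Cid z x x.
Proof.
move=> cC Cz Cx [s ms s01]; apply/ms; rewrite finset.inE /= /ty.
have <- : s o1 = s o2.
  exact/(matches_eq o1 o2 (clique_triple cC Cz Cx Cx) ms).
by rewrite s01 col_id.
Qed.

(** * Iterated successors in a flat representation *)

Section Flat.
Context {m : nat} (hm : 6 <= m).
Hypothesis flatV : flat m cyl3 V f.
Local Notation clique := (clique_assignments m V).

Definition var (k : 'I_6) : 'I_m := widen_ord hm k.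
Local Notation v k := (var (@Ordinal 6 k isT)).

(** The triangle [Cg], [Cs], [Cg] is allowed, so genericity makes the cylindrified element true at
    the triple, and squareness yields a witness in a clique with the other values of [s]. *)
Lemma plane_succ (s : 'I_m -> M) i k q : uniq [:: i; k; q] -> clique s ->
  hascol Cg (s i) (s k) ->
  exists y, clique (update s q y) /\ plane_edge Cs (s i) (s k) y.
Proof.
rewrite /= !inE andbT negb_or => /andP[/andP[ik iq] kq] cs gik.
have Cs_ j : range s (s j) by exists j.
have V1 := clique_triple cs (Cs_ i) (Cs_ k) (Cs_ q).
have V2 := clique_triple cs (Cs_ i) (Cs_ k) (Cs_ k).
have [t mt] := matches_ex V1.
have t01 := hascol_fun (matches_hascol01 V1 V2 mt) gik.
have [|d d0 d1] := @col_ext (t o0) (t o1) Cg Cs; first by rewrite t01.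
have [u [cu su fu]] : exists u : 'I_m -> M, [/\ clique u,
    agree_off (triple i k q o2) s u & f (in_plane Cs) (u \o triple i k q)].
  apply: flatV.1 => //.
  - move=> a b; elim/ord3P: a; elim/ord3P: b; rewrite /triple //= => e; exfalso;
      by move: ik iq kq; rewrite e ?eqxx // -?e ?eqxx.
  - rewrite comp_triple; apply/mt/(in_type_cyl ty_back_forth); exists d.
    by rewrite finset.inE /= /ty /update /= t01 d0 d1.
have {}su : agree_off q s u := su.
exists (u q); rewrite -(agree_off_update su); split=> //.
by move: fu; rewrite comp_triple (su i) ?(su k).
Qed.

(** The clique condition on four points imitates a clique-guarded quantifier over a fourth
    variable. *)
Fixpoint iter_succ (n : nat) (z x y : M) : Prop :=
  if n is n'.+1 then
    exists u, [/\ clique3 V [set z; x; u; y], iter_succ n' z x u &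
                   plane_edge Cs z u y]
  else plane_edge Cid z x y.

Lemma fresh_var (J : {set 'I_m}) : #|J| < m -> exists q, q \notin J.
Proof.
move=> Jm; have : 0 < #|~: J|%SET by rewrite cardsCs finset.setCK card_ord subn_gt0.
by case/card_gt0P => q; rewrite finset.inE; exists q.
Qed.

(** The definition only gives a clique with three of the points; [flat_witness] finds an
    intermediate point in a clique with all of [s] off [q]. Definability one level down is assumed,
    since the induction proving definability relies on this lemma. *)
Lemma iter_succ_witness_of_definable n (s : 'I_m -> M) i j k q : uniq [:: i; j; k; q] ->
  definable V f (fun t => iter_succ n (t i) (t j) (t q)) -> clique s ->
  iter_succ n.+1 (s i) (s j) (s k) ->
  exists u, [/\ clique (update s q u), iter_succ n (s i) (s j) u &
                 plane_edge Cs (s i) u (s k)].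
Proof.
move=> uni defn cs [u [cu nu su]].
pose Q t := iter_succ n (t i) (t j) (t q) /\ plane_edge Cs (t i) (t q) (t k).
pose J : {set 'I_m} := [set i; j; k]%SET.
have qJ : q \notin J.
  move: uni; rewrite !finset.inE /= !inE !negb_or.
  by do 3!rewrite (eq_sym q); case/and4P => /and3P[_ _ ->] /andP[_ ->] ->.
have iJ : i \in J by rewrite !finset.inE eqxx.
have jJ : j \in J by rewrite !finset.inE eqxx orbT.
have kJ : k \in J by rewrite !finset.inE eqxx orbT.
have defQ : definable V f Q.
  apply: definable_and => //; exists (FAtom (in_plane Cs) (triple i q k)) => t _ /=.
  by rewrite comp_triple.
(* Outside [J] and [q] the value [s k] is repeated, which keeps the range inside the four-point
   clique. *)
pose t a := if a == q then u else if a \in J then s a else s k.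
have tJ : {in J, s =1 t}.
  by move=> a aJ; rewrite /t aJ; case: eqP qJ => // <-; rewrite aJ.
have tq : t q = u by rewrite /t eqxx.
have ct : clique t.
  apply: clique3_sub cu => _ [a _ <-]; rewrite /t.
  case: eqP => _; first by left; right.
  case: ifP => [|_]; last by right.
  rewrite !finset.inE => /orP[/orP[]|] /eqP ->; by [do 3!left|do 2!left; right|right].
have Qt : Q t by rewrite /Q tq -!tJ.
have indQ a : a \notin (q |: J)%SET -> indep V a Q.
  move=> aJ v w _ _ vw.
  have e b : b \in (q |: J)%SET -> w b = v b.
    by move=> bJ; apply: vw; apply: contraNneq aJ => <-.
  by rewrite /Q !e // !finset.inE ?eqxx ?orbT.
have [w [cw [w1 w2]]] := flat_witness flatV.2 defQ iJ qJ indQ cs ct tJ Qt.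
have e b : b \in J -> update s q w b = s b.
  by move=> bJ; rewrite /update; case: eqP qJ => // <-; rewrite bJ.
have eq : update s q w q = w by rewrite /update eqxx.
by exists w; move: w1 w2; rewrite (e i) // (e j) // (e k) // eq.
Qed.

(** The formula asks for a witness compatible with all of [s], the definition only with three
    points; the preceding lemma bridges the gap. *)
Lemma iter_succ_definable n (i j k : 'I_m) : uniq [:: i; j; k] ->
  definable V f (fun s => iter_succ n (s i) (s j) (s k)).
Proof.
elim: n i j k => [|n IH] i j k uni.
  by exists (FAtom (in_plane Cid) (triple i j k)) => s _ /=; rewrite comp_triple.
have [|q] := @fresh_var [set i; j; k]%SET.
  rewrite finset.setUC (leq_ltn_trans (leq_card_setU _ _)) // cards1 cards2.
  by case: (_ != _); lia.
rewrite !finset.inE !negb_or => /andP[/andP[qi qj] qk].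
have uni' : uniq [:: i; j; k; q].
  move: uni; rewrite /= !inE !negb_or !(eq_sym _ q) qi qj qk !andbT.
  by case/andP => -> ->.
have uniq_ : uniq [:: i; j; q].
  move: uni; rewrite /= !inE !negb_or !(eq_sym _ q) qi qj !andbT.
  by case/andP => /andP[].
apply: (@definable_iff _ _ _ _ _ (ex_var V q (fun t => iter_succ n (t i) (t j) (t q) /\
    plane_edge Cs (t i) (t q) (t k)))); last first.
  apply: definable_ex_var; apply: definable_and; first exact: IH.
  by exists (FAtom (in_plane Cs) (triple i q k)) => t _ /=; rewrite comp_triple.
move=> s cs; split=> [[t [ct st [nt et]]]|].
  have e b : b != q -> t b = s b by apply: st.
  exists (t q); rewrite -!(e i, e j, e k) 1?eq_sym //; split=> //.
  by apply: clique3_sub ct => _ [[[]|]|] ->; [exists i|exists j|exists q|exists k].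
move=> /(iter_succ_witness_of_definable uni' (IH _ _ _ uniq_) cs)[u [cu nu eu]].
exists (update s q u); split=> //; first exact: update_agree_off.
by rewrite /update eqxx !(eq_sym _ q) (negbTE qi) (negbTE qj) (negbTE qk).
Qed.

Lemma iter_succ_witness n (s : 'I_m -> M) i j k q : uniq [:: i; j; k; q] ->
  clique s -> iter_succ n.+1 (s i) (s j) (s k) ->
  exists u, [/\ clique (update s q u), iter_succ n (s i) (s j) u &
                 plane_edge Cs (s i) u (s k)].
Proof.
move=> uni; apply: iter_succ_witness_of_definable => //; apply: iter_succ_definable.
by move: uni; rewrite /= !inE !negb_or => /and4P[/and3P[-> _ ->] /andP[_ ->]].
Qed.

Definition assign (d : M) (l : seq M) (i : 'I_m) : M := nth d l i.

Lemma clique_assign (C : set M) d l : clique3 V C -> C d ->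
  (forall k, k < size l -> C (nth d l k)) -> clique (assign d l).
Proof.
move=> cC Cd Cl; apply: clique3_sub cC => _ [i _ <-]; rewrite /assign.
by have [/Cl//|il] := ltnP i (size l); rewrite nth_default.
Qed.

Lemma clique_assign4 z x u y : clique3 V [set z; x; u; y] ->
  clique (assign z [:: z; x; u; y]).
Proof.
move=> cC; apply: (clique_assign cC); first by do 3!left.
by case=> [|[|[|[|//]]]] _ /=; [do 3!left|do 2!left; right|left; right|right].
Qed.

Lemma iter_succ_plane (C : set M) n z x y : clique3 V C -> C z -> C x -> C y ->
  iter_succ n z x y -> hascol Cg z y.
Proof.
case: n => [|n] cC Cz Cx Cy; first by case/(plane_edge_hascol cC Cz Cx Cy).
move=> [u [cu _ /(plane_edge_hascol cu _ _ _)[]]] //; first by do 3!left.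
  by left; right.
by right.
Qed.

(** The predecessors of [u] and [y] coincide by induction. Two points of one plane are equal or
    ordered, and two successors of the same point are not ordered. *)
Lemma iter_succ_fun n z x u y : clique3 V [set z; x; u; y] ->
  iter_succ n z x u -> iter_succ n z x y -> u = y.
Proof.
elim: n z x u y => [|n IH] z x u y cC nu ny.
  have Cz : [set z; x; u; y] z by do 3!left.
  have Cx : [set z; x; u; y] x by do 2!left; right.
  have Cu : [set z; x; u; y] u by left; right.
  have Cy : [set z; x; u; y] y by right.
  have [_ _ /(hascol_id cC Cx Cu) <-] := plane_edge_hascol cC Cz Cx Cu nu.
  by have [_ _ /(hascol_id cC Cx Cy)] := plane_edge_hascol cC Cz Cx Cy ny.
(* The predecessors go to variables 4 and 5 one after the other, giving a clique on all six points;
   this is where six variables are used. *)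
have [a [ca na sa]] := @iter_succ_witness n _ (v 0) (v 1) (v 2) (v 4) isT
  (clique_assign4 cC) nu.
have [b [cb nb sb]] := @iter_succ_witness n _ (v 0) (v 1) (v 3) (v 5) isT ca ny.
have Cb k : range (update (update (assign z [:: z; x; u; y]) (v 4) a) (v 5) b)
  (update (update (assign z [:: z; x; u; y]) (v 4) a) (v 5) b k) by exists k.
have [Cz Cx Cu Cy] := And4 (Cb (v 0)) (Cb (v 1)) (Cb (v 2)) (Cb (v 3)).
have [Ca Cb'] := (Cb (v 4), Cb (v 5)).
rewrite /update /assign /= in Cz Cx Cu Cy Ca Cb'.
have ab : a = b.
  by apply: (IH z x) => //; apply: clique3_sub cb => _ [[[]|]|] ->.
have [_ gu su] := plane_edge_hascol cb Cz Ca Cu sa.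
have [_ gy sy] := plane_edge_hascol cb Cz Cb' Cy sb.
have [c cuy] := hascol_ex cb Cu Cy.
have t1 := hascol_triangle cb Cz Cu Cy gu cuy gy.
have t2 : triangle Cs c Cs.
  by apply: hascol_triangle cb Ca Cu Cy su cuy _; rewrite ab.
apply/(hascol_id cb Cu Cy).
by move: t1 t2 cuy; case: c.
Qed.

(** Induction on [k] through the predecessor [b] of [y]: at first [b] is [u] by uniqueness, later
    [u] is below [b]. Then [u] and [y], being in one plane, are equal or ordered, and the absence of
    cycles leaves only [u] below [y]. *)
Lemma iter_succ_below n k z x u y : clique3 V [set z; x; u; y] ->
  iter_succ n z x u -> iter_succ (n + k).+1 z x y ->
  exists2 c, below c & hascol c u y.
Proof.
elim: k z x u y => [|k IH] z x u y cC nu ny;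
  have [b [cb nb sb]] := @iter_succ_witness _ _ (v 0) (v 1) (v 3) (v 4) isT
    (clique_assign4 cC) ny;
  have Cb k' : range (update (assign z [:: z; x; u; y]) (v 4) b)
    (update (assign z [:: z; x; u; y]) (v 4) b k') by [exists k'];
  have [Cz Cx Cu Cy] := And4 (Cb (v 0)) (Cb (v 1)) (Cb (v 2)) (Cb (v 3));
  have Cb' := Cb (v 4);
  rewrite /update /assign /= in Cz Cx Cu Cy Cb';
  have cub : clique3 V [set z; x; u; b] by
    [apply: clique3_sub cb => _ [[[]|]|] ->];
  have [gb gy sy] := plane_edge_hascol cb Cz Cb' Cy sb.
  rewrite addn0 in nb; rewrite (iter_succ_fun cub nu nb).
  by exists Cs.
rewrite addnS in nb; have [e be ub] := IH _ _ _ _ cub nu nb.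
have [c cuy] := hascol_ex cb Cu Cy; exists c => //.
have t1 := hascol_triangle cb Cu Cb' Cy ub sy cuy.
have gu := iter_succ_plane cb Cz Cx Cu nu.
have t2 := hascol_triangle cb Cz Cu Cy gu cuy gy.
by move: be t1 t2; case: (e) => //; case: (c).
Qed.

Lemma iter_succ_total n z x : clique3 V [set z; x] -> hascol Cg z x ->
  exists u, clique3 V [set z; x; u] /\ iter_succ n z x u.
Proof.
move=> czx gzx; elim: n => [|n [u [cu nu]]].
  exists x; split; first by apply: clique3_sub czx => _ [[]|] ->; [left|right|right].
  by apply: (plane_edge_id czx) => //; [left|right].
have Cz : [set z; x; u] z by do 2!left.
have Cx : [set z; x; u] x by left; right.
have Cu : [set z; x; u] u by right.
have ca : clique (assign z [:: z; x; u]).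
  by apply: (clique_assign cu) => // -[|[|[|//]]].
have gzu := iter_succ_plane cu Cz Cx Cu nu.
have [y [cy sy]] := @plane_succ _ (v 0) (v 2) (v 3) isT ca gzu.
have Cb k : range (update (assign z [:: z; x; u]) (v 3) y)
  (update (assign z [:: z; x; u]) (v 3) y k) by exists k.
have [Dz Dx Du Dy] := And4 (Cb (v 0)) (Cb (v 1)) (Cb (v 2)) (Cb (v 3)).
rewrite /update /assign /= in Dz Dx Du Dy.
exists y; split; first by apply: clique3_sub cy => _ [[]|] ->.
by exists u; split=> //; apply: clique3_sub cy => _ [[[]|]|] ->.
Qed.

Lemma flat_infinite : infinite_set [set: M].
Proof.
(* A starting point [d] in the plane of the node 0. *)
have [d _ dg] := @col_ext 0 0 Cg Cg isT.
have [w Vw mw] := matches_onto (triple 0 d d).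
have czx : clique3 V [set w o0; w o1].
  by apply: (@pair_clique _ _ (w o2)); rewrite -tripleE.
have gzx : hascol Cg (w o0) (w o1).
  rewrite -dg; rewrite (tripleE w) in mw Vw.
  apply: (matches_hascol01 Vw _ mw).
  by apply: (@clique_triple _ _ _ _ czx); [left|right|right].
have [u uP] := choice (fun n => @iter_succ_total n _ _ czx gzx).
move=> fin.
(* Different iterates need not share a clique; but if they coincide, the clique of one suffices for
   [iter_succ_below], which puts that point below itself. *)
have lt_neq n k : u n <> u (n + k).+1.
  move=> e; have [cn nn] := uP n; have [_ nk] := uP (n + k).+1.
  rewrite -e in nk.
  have [|c bc un] := @iter_succ_below n k _ _ _ _ _ nn nk.
    by apply: clique3_sub cn => a [//|->]; right.
  have Cu : [set w o0; w o1; u n] (u n) by right.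
  have := (hascol_id cn Cu Cu).2 erefl.
  by move=> /(hascol_fun un) ec; rewrite ec in bc.
have uinj : injective u.
  move=> a b uab; have [ab|ab|//] := ltngtP a b.
    by case: (lt_neq a (b - a.+1)); rewrite uab; congr u; lia.
  by case: (lt_neq b (a - b.+1)); rewrite -uab; congr u; lia.
exact: infinite_nat (finite_preimage (in2W uinj) fin).
Qed.

End Flat.
End Representation.

Theorem theorem3p12 (m : nat) (hm : (6 <= m)%N) :
  exists (d : Order.disp_t) (A : finCTBDistrLatticeType d)
         (cyl : 'I_3 -> A -> A) (diag : 'I_3 -> 'I_3 -> A),
    [/\ cylindric_algebra3 cyl diag,
        exists (M : Type) (V : set ('I_3 -> M)) (f : A -> set ('I_3 -> M)),
          flat_representation m cyl diag V f /\ infinite_set [set: M]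
      & ~ exists (M : Type) (V : set ('I_3 -> M)) (f : A -> set ('I_3 -> M)),
          flat_representation m cyl diag V f /\ finite_set [set: M]].
Proof.
have full := type_rep_full ty_back_forth ty_eq.
exists _, {set types ty}, cyl3, diag3; split.
- exact: cylindric_algebra3_full full.
- exists nat, setT, (@type_rep _ _ ty); split; last exact: infinite_nat.
  by split; [exact: full|exact: flat_full full].
- by move=> [M [V [f [[rep flatV] fin]]]]; apply: (flat_infinite rep hm flatV).
Qed.
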